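(* Let $K$ be a compact Hausdorff space with an isolated point and let $X$ be a real Banach space. Then: (a) if $C(K,X)^*$ has the $w^*$-Strong diameter two property, then $X^*$ has the $w^*$-Strong diameter two property; (b) if $C(K,X)^*$ has the $w^*$-diameter two property, then $X^*$ has the $w^*$-diameter two property; (c) if $C(K,X)^*$ has the $w^*$-Slice diameter two property, then $X^*$ has the $w^*$-Slice diameter two property.
   Context: All Banach spaces are real and nonzero. $C(K,X)$ is the Banach space of continuous functions from $K$ to $X$ with the supremum norm. For a Banach space $Z$, $Z^*$ is its dual and $B_Z$ its closed unit ball. Diameters are taken with respect to the norm. $w^*$-slices. For a Banach space $Z$, a $w^*$-slice of $B_{Z^*}$ is a set of the form $\{z^* \in B_{Z^*} : z^*(z) > \sup_{u^* \in B_{Z^*}} u^*(z) - \alpha\}$ with $z \in Z$ and $\alpha > 0$. A convex combination of $w^*$-slices of $B_{Z^*}$ is a set $\sum_{i=1}^n \lambda_i S_i = \{\sum_{i=1}^n \lambda_i s_i : s_i \in S_i\}$, where $n \geq 1$, each $S_i$ is a $w^*$-slice of $B_{Z^*}$, $\lambda_i \in [0,1]$ and $\sum_{i=1}^n \lambda_i = 1$. The dual space $Z^*$ has: - the $w^*$-Slice diameter two property if every $w^*$-slice of $B_{Z^*}$ has diameter $2$; - the $w^*$-diameter two property if every nonempty relatively $w^*$-open subset of $B_{Z^*}$ (for the topology $\sigma(Z^*,Z)$) has diameter $2$; - the $w^*$-Strong diameter two property if every convex combination of $w^*$-slices of $B_{Z^*}$ has diameter $2$. *)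

(* Defs.v *)
From HB Require Import structures.
From mathcomp Require Import all_boot all_order all_algebra.
From mathcomp Require Import all_classical all_reals all_analysis.
From mathcomp Require Import ring.

Set Implicit Arguments.
Unset Strict Implicit.
Unset Printing Implicit Defensive.

Import Order.TTheory GRing.Theory Num.Theory.
Import numFieldNormedType.Exports.

Local Open Scope classical_set_scope.
Local Open Scope ring_scope.

Definition unit_ball {R : realType} (V : normedModType R) : set V :=
  [set v | `|v| <= 1].
Arguments unit_ball {R} V.

(* The empty set gets -oo; every other set gets its usual diameter in [0, +oo]. *)
Definition diameter {R : realType} {V : normedModType R} (A : set V) : \bar R :=
  ereal_sup [set `|p.1 - p.2|%:E | p in A `*` A].

Section dual.
Context {R : realType} (Z : normedModType R).

Definition is_dual : {pred (Z -> R^o)} :=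
  mem [set f : Z -> R^o | linear f /\ continuous f].

Record dual : Type := Dual {
  dual_fun :> Z -> R^o;
  dual_funP : dual_fun \in is_dual }.

HB.instance Definition _ := [isSub for dual_fun].
HB.instance Definition _ := gen_eqMixin dual.
HB.instance Definition _ := gen_choiceMixin dual.

Lemma dual_linear (f : dual) : linear f.
Proof. by have /set_mem[] := dual_funP f. Qed.

Lemma dual_continuous (f : dual) : continuous f.
Proof. by have /set_mem[] := dual_funP f. Qed.

HB.instance Definition _ (f : dual) :=
  GRing.isLinear.Build R Z R^o *:%R f (@dual_linear f).

HB.instance Definition _ (f : dual) :=
  isContinuous.Build Z R^o f (@dual_continuous f).

Lemma is_dual_submod_closed : submod_closed is_dual.
Proof.
split.
  apply/mem_set; split; last exact: cst_continuous.
  by move=> a x y; rewrite scaler0 addr0.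
move=> a f g /set_mem[lf cf] /set_mem[lg cg]; apply/mem_set; split.
  move=> b x y; rewrite -[LHS]/(a *: f _ + g _) lf lg.
  rewrite -[X in _ = b *: X + _]/(a *: f x + g x).
  rewrite -[X in _ = _ + X]/(a *: f y + g y).
  by rewrite !scalerDr !scalerA addrACA mulrC.
by move=> x; apply: cvgD; [apply: cvgZl_tmp; exact: cf | exact: cg].
Qed.

HB.instance Definition _ := GRing.isSubmodClosed.Build _ _ is_dual
  is_dual_submod_closed.
HB.instance Definition _ := [SubChoice_isSubLmodule of dual by <:].

Definition dual_norm (f : dual) : R := sup [set `|f z| | z in unit_ball Z].

Lemma dual_norm_has_sup (f : dual) : has_sup [set `|f z| | z in unit_ball Z].
Proof.
split; first by exists `|f 0|, 0 => //=; rewrite /unit_ball/= normr0.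
have : bounded_near f (nbhs (0 : Z)).
  exact/linear_bounded_continuous/dual_continuous.
move=> /bounded_funP/(_ 1)[M fM]; exists M => _ [z z1 <-]; exact: fM.
Qed.

Lemma dual_norm_ge (f : dual) z : `|z| <= 1 -> `|f z| <= dual_norm f.
Proof. by move=> z1; apply: ub_le_sup; [exact: (dual_norm_has_sup f).2|exists z]. Qed.

Lemma dual_norm_le (f : dual) M :
  (forall z, `|z| <= 1 -> `|f z| <= M) -> dual_norm f <= M.
Proof.
move=> fM; apply: ge_sup; first exact: (dual_norm_has_sup f).1.
by move=> _ [z z1 <-]; exact: fM.
Qed.

Lemma le_dual_normD (f g : dual) :
  dual_norm (f + g) <= dual_norm f + dual_norm g.
Proof.
apply: dual_norm_le => z z1; apply: (le_trans (ler_normD _ _)).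
by rewrite lerD// dual_norm_ge.
Qed.

Lemma dual_normZ (a : R) (f : dual) : dual_norm (a *: f) = `|a| * dual_norm f.
Proof.
have le b g : dual_norm (b *: g) <= `|b| * dual_norm g.
  apply: dual_norm_le => z z1.
  by rewrite [X in X <= _]normrM ler_wpM2l// dual_norm_ge.
have [->|a0] := eqVneq a 0.
  rewrite normr0 mul0r scale0r; apply/eqP; rewrite eq_le; apply/andP; split.
    by apply: dual_norm_le => z _; rewrite normr0.
  by apply: le_trans (@dual_norm_ge 0 0 _); rewrite ?normr0.
apply/eqP; rewrite eq_le le/= -ler_pdivlMl ?normr_gt0// -normfV.
by rewrite -[X in dual_norm X <= _](scalerK a0) le.
Qed.

Lemma dual_norm_eq0 (f : dual) : dual_norm f = 0 -> f = 0.
Proof.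
move=> f0; apply/val_inj/funext => z; rewrite -[RHS]/(0 : R^o).
have [->|z0] := eqVneq z 0; first exact: (linear0 f).
have := @dual_norm_ge f (`|z|^-1 *: z).
rewrite f0 normrZ normfV normr_id mulVf ?normr_eq0// lexx normr_le0.
move=> /(_ isT)/eqP; rewrite linearZ/= => /eqP.
by rewrite scaler_eq0 invr_eq0 normr_eq0 (negbTE z0) => /eqP.
Qed.

HB.instance Definition _ :=
  Lmodule_isNormed.Build R dual le_dual_normD dual_normZ dual_norm_eq0.

Lemma dual_normE (f : dual) :
  `|f| = sup [set `|f z| | z in unit_ball Z].
Proof. by []. Qed.

(* sigma(Z^*, Z): the coarsest topology on the dual making all the evaluations
   f |-> f z continuous, i.e., the one induced by pointwise convergence. *)
Definition weak_star : Type := dual.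

HB.instance Definition _ := Choice.copy weak_star dual.
HB.instance Definition _ := Topological.copy weak_star
  (initial_topology (dual_fun : dual -> {ptws Z -> R^o})).

End dual.

(* The compactness proof is a parameter because it is what makes the supremum
   norm below finite. *)
Definition contfun {R : realType} (K : topologicalType)
    (cK : compact [set: K]) (X : normedModType R) : Type :=
  continuousType K X.

Section contfun.
Context {R : realType} (K : topologicalType) (cK : compact [set: K]).

Section normed.
Context (X : normedModType R).
Local Notation C := (contfun cK X).

Definition contfun_val (f : C) : K -> X := (f : continuousType K X).
Coercion contfun_val : contfun >-> Funclass.

Definition is_contfun : {pred (K -> X)} := mem [set f : K -> X | continuous f].

Definition Contfun (f : K -> X) (cf : f \in is_contfun) : C :=
  (mkcts (set_mem cf) : continuousType K X).

Lemma contfun_continuous (f : C) : continuous f.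
Proof. exact: (@cts_fun _ _ (f : continuousType K X)). Qed.

Lemma contfun_inj : injective contfun_val.
Proof.
move=> f g fg; apply/continuousEP => x.
by rewrite -[LHS]/(contfun_val f x) fg.
Qed.

Lemma contfun_rect (P : C -> Type) :
  (forall f (cf : f \in is_contfun), P (Contfun cf)) -> forall f, P f.
Proof.
move=> PC f; have cf : contfun_val f \in is_contfun.
  by apply/mem_set; exact: contfun_continuous.
by rewrite (_ : f = Contfun cf); [exact: PC|exact: contfun_inj].
Qed.

HB.instance Definition _ := isSub.Build (K -> X) _ C
  contfun_rect (fun f (cf : f \in is_contfun) => erefl : contfun_val (Contfun cf) = f).
HB.instance Definition _ := gen_eqMixin C.
HB.instance Definition _ := gen_choiceMixin C.

Lemma is_contfun_submod_closed : submod_closed is_contfun.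
Proof.
split; first by apply/mem_set; exact: cst_continuous.
move=> a f g /set_mem cf /set_mem cg; apply/mem_set => x.
by apply: cvgD; [apply: cvgZl_tmp; exact: cf | exact: cg].
Qed.

HB.instance Definition _ := GRing.isSubmodClosed.Build _ _ is_contfun
  is_contfun_submod_closed.
HB.instance Definition _ := [SubChoice_isSubLmodule of C by <:].

(* For empty K the supremum of the empty set is 0, as it should be. *)
Definition sup_norm (f : C) : R := sup [set `|f k| | k in [set: K]].

Lemma sup_norm_ge (f : C) k : `|f k| <= sup_norm f.
Proof.
apply: ub_le_sup; last by exists k.
have /compact_bounded : compact (f @` [set: K]).
  apply: continuous_compact => //.
  exact/continuous_subspaceT/contfun_continuous.
move=> [M [_ fM]]; exists (M + 1) => _ [x _ <-].
by apply: fM; [rewrite ltrDl|exists x].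
Qed.

Lemma sup_norm_le (f : C) M :
  0 <= M -> (forall k, `|f k| <= M) -> sup_norm f <= M.
Proof.
move=> M0 fM; have [[k _]|K0] := pselect ([set: K] !=set0).
  by apply: ge_sup; [exists `|f k|, k|move=> _ [x _ <-]].
rewrite /sup_norm (_ : [set _ | _ in _] = set0) ?sup0//.
by rewrite -subset0 => t [x _ _]; apply: K0; exists x.
Qed.

Lemma sup_norm_ge0 (f : C) : 0 <= sup_norm f.
Proof.
have [[k _]|K0] := pselect ([set: K] !=set0).
  exact: le_trans (sup_norm_ge f k).
rewrite /sup_norm (_ : [set _ | _ in _] = set0) ?sup0//.
by rewrite -subset0 => t [x _ _]; apply: K0; exists x.
Qed.

Lemma le_sup_normD (f g : C) : sup_norm (f + g) <= sup_norm f + sup_norm g.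
Proof.
apply: sup_norm_le => [|k]; first by rewrite addr_ge0// sup_norm_ge0.
by apply: (le_trans (ler_normD _ _)); rewrite lerD// sup_norm_ge.
Qed.

Lemma sup_normZ (a : R) (f : C) : sup_norm (a *: f) = `|a| * sup_norm f.
Proof.
have le b g : sup_norm (b *: g) <= `|b| * sup_norm g.
  apply: sup_norm_le => [|k]; first by rewrite mulr_ge0// sup_norm_ge0.
  by rewrite [X in X <= _]normrZ ler_wpM2l// sup_norm_ge.
have [->|a0] := eqVneq a 0.
  rewrite normr0 mul0r scale0r; apply/eqP; rewrite eq_le sup_norm_ge0 andbT.
  by apply: sup_norm_le => // k; rewrite normr0.
apply/eqP; rewrite eq_le le/= -ler_pdivlMl ?normr_gt0// -normfV.
by rewrite -[X in sup_norm X <= _](scalerK a0) le.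
Qed.

Lemma sup_norm_eq0 (f : C) : sup_norm f = 0 -> f = 0.
Proof.
move=> f0; apply/contfun_inj/funext => k; apply/eqP; rewrite -normr_le0 -f0.
exact: sup_norm_ge.
Qed.

HB.instance Definition _ :=
  Lmodule_isNormed.Build R C le_sup_normD sup_normZ sup_norm_eq0.

Lemma sup_normE (f : C) : `|f| = sup [set `|f k| | k in [set: K]].
Proof. by []. Qed.

End normed.

Section complete.
Context (X : completeNormedModType R).
Local Notation C := (contfun cK X).

Lemma contfun_complete (F : set_system C) : ProperFilter F -> cauchy F -> cvg F.
Proof.
move=> FF /cauchyP Fc.
have Fk k : cvg ((fun f : C => f k) @ F).
  apply: cauchy_cvg; apply/cauchyP => e e0.
  have [f Ff] := Fc e e0; exists (f k).
  suff : F [set g : C | ball (f k) e (g k)] by [].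
  apply: filterS Ff => g; rewrite -!ball_normE/=; apply: le_lt_trans.
  exact: (sup_norm_ge (f - g) k).
pose l k : X := lim ((fun f : C => f k) @ F).
have Fl e : 0 < e -> F [set f : C | forall k, `|l k - f k| <= e].
  move=> e0; have e30 : 0 < e / 3 by rewrite divr_gt0.
  have e3E : e = e / 3 + (e / 3 + e / 3) by field.
  have [f Ff] := Fc _ e30.
  apply: filterS (Ff) => g; rewrite -ball_normE/= => fg k.
  have Fh : F [set h : C | `|l k - h k| <= e / 3].
    by have /cvgrPdist_le/(_ _ e30) := Fk k.
  have [h [/= lh]] := filter_ex (filterI Fh Ff).
  rewrite -ball_normE/= => fh.
  rewrite e3E (le_trans (ler_distD (h k) _ _))// lerD//.
  rewrite (le_trans (ler_distD (f k) _ _))// lerD//.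
    by rewrite distrC (le_trans (sup_norm_ge (f - h) k))// ltW.
  exact: le_trans (sup_norm_ge (f - g) k) (ltW fg).
have cl : continuous l.
  move=> k; apply/cvgrPdist_le => e e0.
  have e30 : 0 < e / 3 by rewrite divr_gt0.
  have [f lf] := filter_ex (Fl _ e30).
  have /cvgrPdist_le/(_ _ e30) := @contfun_continuous X f k.
  apply: filterS => h fkh.
  rewrite (_ : e = e / 3 + (e / 3 + e / 3)); last by field.
  rewrite (le_trans (ler_distD (f k) _ _))// lerD//.
  by rewrite (le_trans (ler_distD (f h) _ _))// lerD// distrC.
have cl' : l \in @is_contfun X by apply/mem_set.
apply/cvg_ex; exists (Contfun cl' : C); apply/cvgrPdist_le => e e0.
apply: filterS (Fl _ e0) => f lf.
by apply: sup_norm_le; [exact: ltW|exact: lf].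
Qed.

HB.instance Definition _ := Uniform_isComplete.Build C contfun_complete.

End complete.
End contfun.

Section diameter_two.
Context {R : realType}.

Definition wstar_slice (Z : normedModType R) (z : Z) (alpha : R) :
    set (dual Z) :=
  [set f | unit_ball (dual Z) f /\
    f z > sup [set (u : dual Z) z | u in unit_ball (dual Z)] - alpha].

Definition is_wstar_slice (Z : normedModType R) (S : set (dual Z)) : Prop :=
  exists (z : Z) (alpha : R), 0 < alpha /\ S = wstar_slice z alpha.

Definition is_convex_comb_wstar_slices (Z : normedModType R)
    (C : set (dual Z)) : Prop :=
  exists (n : nat) (S : 'I_n -> set (dual Z)) (lambda : 'I_n -> R),
    [/\ (1 <= n)%N, forall i, is_wstar_slice (S i),
        forall i, 0 <= lambda i <= 1, \sum_(i < n) lambda i = 1 &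
        C = [set \sum_(i < n) lambda i *: s i |
              s in [set s : 'I_n -> dual Z | forall i, S i (s i)]]].

(* Openness is taken in [weak_star Z], not in the norm topology of [dual Z]. *)
Definition is_relatively_wstar_open (Z : normedModType R)
    (W : set (dual Z)) : Prop :=
  exists U : set (weak_star Z), open U /\ W = unit_ball (dual Z) `&` U.

(* The three properties below are properties of the dual of the Banach space Z
   given as argument; they depend on the predual Z through the w*-topology. *)
Definition wstar_slice_diameter_two (Z : completeNormedModType R) : Prop :=
  forall S : set (dual Z), is_wstar_slice S -> diameter S = 2%:E.

Definition wstar_diameter_two (Z : completeNormedModType R) : Prop :=
  forall W : set (dual Z),
    is_relatively_wstar_open W -> W !=set0 -> diameter W = 2%:E.

Definition wstar_strong_diameter_two (Z : completeNormedModType R) : Prop :=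
  forall C : set (dual Z),
    is_convex_comb_wstar_slices C -> diameter C = 2%:E.

End diameter_two.

(* Main.v *)
From HB Require Import structures.
Require Import Defs.
From mathcomp Require Import all_boot all_order all_algebra.
From mathcomp Require Import all_classical all_reals all_analysis.
From mathcomp Require Import lra ring.

Import Order.TTheory GRing.Theory Num.Theory.
Import numFieldNormedType.Exports.

Local Open Scope classical_set_scope.
Local Open Scope ring_scope.

(** If [k0] is isolated in [K], the functions supported by [k0] form a copy of
    [X] in [Z = C(K, X)]: the map [J] sends [x] to the function equal to [x] at
    [k0] and to [0] elsewhere, and evaluation [P] at [k0] is a left inverse of
    [J].  The norm of [Z] is the maximum of the norms of the [X]-part and of the
    rest ([spike_M_summand]), so that [Z^*] is the l^1-sum of [X^*] and of a
    complement.  The theorem holds for any such M-summand.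

    Write [J^*] for restriction to [X], [P^*] for the embedding of [X^*] in
    [Z^*].  The l^1 norm has the following effect: a functional [F] of
    the unit ball of [Z^*] whose value at [J x], for some [x] of norm at
    most [r], is close to [r] has no room left for its complementary
    part, i.e. [F - P^* (J^* F)] is small ([M_summand_remainder]).  Hence a
    subset of the ball of [X^*] has diameter 2 as soon as it contains, for every
    [e > 0], the restrictions of a diameter 2 set of functionals whose
    complementary parts are smaller than [e] ([M_summand_diameter]).

    For a slice of the ball of [X^*] given by [x <> 0], the thin slices given by
    [J x] are such sets ([M_summand_slice]); the supremum defining a slice is
    the norm of [x] by the Hahn-Banach theorem ([norming_functional]).  Convex
    combinations of slices follow termwise.  For a relatively w*-open set [W],
    the sets to use are the intersections of the preimage of [W] with a thin
    slice given by a point where some [f] in [W] nearly attains its norm; this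
    requires that [W] contain a functional of norm 1, so that the thin slice
    meets the preimage.  Such functionals exist because slices of the
    ball of [X^*] have diameter 2, by the slice case: this forces [X^*] to contain large
    functionals that are small on any given finite set
    ([big_functional_small_on_finite]), along which one can move inside [W]
    until the unit sphere is reached ([wstar_open_meets_sphere]). *)

(** * Norming functionals *)

Section hahn_banach.
Context {R : realType} {V : normedModType R}.
Implicit Types (p q : V -> R) (x y : V).

(** The inequality for [a *: x] suffices: applied to [a] and to [a^-1] it gives
    the equality [sublinearZ], and it forces [p 0 = 0]. *)
Definition sublinear p :=
  (forall x y, p (x + y) <= p x + p y) /\
  (forall a x, 0 <= a -> p (a *: x) <= a * p x).

Lemma sublinear0 p : sublinear p -> p 0 = 0.
Proof.
move=> [pD pZ]; have := pD 0 0; have := pZ 0 0 (lexx _).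
by rewrite scale0r addr0; lra.
Qed.

Lemma sublinear_oppr p x : sublinear p -> - p (- x) <= p x.
Proof.
by move=> sp; have := sp.1 x (- x); rewrite subrr sublinear0//; lra.
Qed.

(** The infimum is finite because [p x >= - p (- x) >= - q (- x)].  Directedness
    allows subadditivity to be checked on a single member of the family lying
    below two given ones. *)
Lemma sublinear_chain_inf q (A : set (V -> R)) :
  A !=set0 ->
  (forall p, A p -> sublinear p /\ forall x, p x <= q x) ->
  (forall p p', A p -> A p' -> exists2 r, A r & forall x, r x <= p x /\ r x <= p' x) ->
  let m x := inf [set p x | p in A] in
  sublinear m /\ forall p x, A p -> m x <= p x.
Proof.
move=> [p0 Ap0] Aq Adir m.
have mle p x : A p -> m x <= p x.
  move=> Ap; apply: ge_inf; last by exists p.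
  exists (- q (- x)) => _ [r Ar <-]; have [sr rq] := Aq _ Ar.
  by rewrite (le_trans _ (sublinear_oppr _ x sr))// lerN2.
have lem x c : (forall p, A p -> c <= p x) -> c <= m x.
  by move=> cA; apply: lb_le_inf; [exists (p0 x), p0|move=> _ [p Ap <-]; exact: cA].
split=> //; split=> [x y|a x a0].
  rewrite -lerBlDl; apply: (lem y) => p Ap.
  rewrite lerBlDl -lerBlDr; apply: (lem x) => p' Ap'.
  have [r Ar rpp] := Adir p p' Ap Ap'.
  have := (Aq r Ar).1.1 x y; have := mle r (x + y) Ar.
  have := (rpp x).2; have := (rpp y).1; lra.
have [->|a1] := eqVneq a 0.
  have := mle p0 0 Ap0; rewrite (sublinear0 _ (Aq _ Ap0).1).
  by rewrite scale0r mul0r.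
have {a0 a1}a0 : 0 < a by rewrite lt_def a1.
rewrite -ler_pdivrMl//; apply: lem => p Ap.
by rewrite ler_pdivrMl// (le_trans (mle p _ Ap))// (Aq p Ap).1.2// ltW.
Qed.

(** Minimal sublinear functionals are linear ([minimal_sublinear_linear]), so
    that this is the existence part of the Hahn-Banach theorem. *)
Lemma minimal_sublinear q : sublinear q ->
  exists m, [/\ sublinear m, forall x, m x <= q x &
    forall p, sublinear p -> (forall x, p x <= m x) -> p = m].
Proof.
move=> sq.
pose T := {p : V -> R | sublinear p /\ forall x, p x <= q x}.
(* Zorn's lemma yields maximal elements, hence the reversed order. *)
pose below (s t : T) := `[< forall x, sval t x <= sval s x >].
have [| | | |[m [sm mq]] mmin] := @Zorn T below.
- by move=> t; apply/asboolP.
- move=> r s t /asboolP rs /asboolP st; apply/asboolP => x.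
  exact: le_trans (st x) (rs x).
- move=> [s Ps] [t Pt] /asboolP st /asboolP ts; apply: eq_exist => /=.
  by apply/funext => x; apply/eqP; rewrite eq_le; apply/andP; split; [exact: ts|exact: st].
- move=> A totA; have [[t0 At0]|A0] := pselect (A !=set0); last first.
    by exists (exist _ q (conj sq (fun x => lexx _))) => s As; case: A0; exists s.
  have [||| sm mle] := @sublinear_chain_inf q [set sval t | t in A].
  + by exists (sval t0), t0.
  + by move=> _ [t At <-]; exact: (svalP t).
  + move=> _ _ [s As <-] [t At <-].
    by have [/asboolP st|/asboolP ts] := totA s t As At;
      [exists (sval t)|exists (sval s)] => //; [exists t|exists s].
  + pose m x := inf [set p x | p in [set sval t | t in A]].
    have mq : sublinear m /\ forall x, m x <= q x.
      split=> // x; apply: le_trans ((svalP t0).2 x).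
      by apply: mle; exists t0.
    by exists (exist _ m mq) => s As; apply/asboolP => x; apply: mle; exists s.
exists m; split=> // p sp pm.
have pq : sublinear p /\ forall x, p x <= q x.
  by split=> // x; exact: le_trans (pm x) (mq x).
have : (exist _ p pq : T) = exist _ m (conj sm mq) by apply: mmin; exact/asboolP.
by move=> /(congr1 (@sval _ _)).
Qed.

(** The derivative of [q] at [x] in the direction [y]: the quantity under the
    infimum is the difference quotient with increment [t^-1], nonincreasing in
    [t].  Passing from [q] to it brings the value at [- x] down to [- q x]. *)
Definition directional q x y : R :=
  inf [set q (y + t *: x) - t * q x | t in [set t | 0 <= t]].

Lemma sublinearZ p a x : sublinear p -> 0 <= a -> p (a *: x) = a * p x.
Proof.
move=> sp a0; apply/eqP; rewrite eq_le sp.2//=.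
have [->|a1] := eqVneq a 0; first by rewrite scale0r mul0r sublinear0.
have {a0 a1}a0 : 0 < a by rewrite lt_def a1.
rewrite -ler_pdivlMl//.
have := sp.2 a^-1 (a *: x); rewrite scalerA mulVf ?gt_eqF// scale1r; apply.
by rewrite invr_ge0 ltW.
Qed.

Lemma directional_sublinear q x : sublinear q ->
  [/\ sublinear (directional q x), forall y, directional q x y <= q y &
      directional q x (- x) <= - q x].
Proof.
move=> sq; pose d := directional q x.
have dle t y : 0 <= t -> d y <= q (y + t *: x) - t * q x.
  move=> t0; apply: ge_inf; last by exists t.
  exists (- q (- y)) => _ [s /= s0 <-].
  have := sq.1 (y + s *: x) (- y); rewrite addrC addKr sublinearZ//; lra.
have led c y : (forall t, 0 <= t -> c <= q (y + t *: x) - t * q x) -> c <= d y.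
  move=> cq; apply: lb_le_inf; first by exists (q (y + 0 *: x) - 0 * q x), 0 => /=.
  by move=> _ [t t0 <-]; exact: cq.
split.
- split=> [y z|a y a0].
    rewrite -lerBlDl; apply: (led _ z) => t t0.
    rewrite lerBlDl -lerBlDr; apply: (led _ y) => s s0.
    have := dle (s + t) (y + z) (addr_ge0 s0 t0).
    have := sq.1 (y + s *: x) (z + t *: x).
    rewrite addrACA -scalerDl -/d; lra.
  have [->|a1] := eqVneq a 0.
    have := dle 0 0 (lexx _).
    by rewrite !scale0r !mul0r addr0 subr0 (sublinear0 q).
  have {a0 a1}a0 : 0 < a by rewrite lt_def a1.
  rewrite -ler_pdivrMl//; apply: led => t t0.
  rewrite ler_pdivrMl//; apply: (le_trans (dle (a * t) _ _)).
    by rewrite mulr_ge0// ltW.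
  by rewrite -scalerA -scalerDr (sublinearZ q _ _ sq (ltW a0)) -mulrA -mulrBr.
- by move=> y; have := dle 0 y (lexx _); rewrite scale0r mul0r addr0 subr0.
- by have := dle 1 (- x) ler01; rewrite scale1r addNr sublinear0// mul1r sub0r.
Qed.

(** By minimality [m] equals [directional m x], so that [m (- x) <= - m x] for
    every [x]: [m] is odd, and an odd sublinear functional is linear. *)
Lemma minimal_sublinear_linear m :
  sublinear m -> (forall p, sublinear p -> (forall x, p x <= m x) -> p = m) ->
  linear (m : V -> R^o).
Proof.
move=> sm mmin.
have mN x : m (- x) = - m x.
  have [sd dm dN] := directional_sublinear m x sm.
  rewrite (mmin _ sd dm) in dN.
  by apply/eqP; rewrite eq_le dN lerNl sublinear_oppr.
have mD x y : m (x + y) = m x + m y.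
  apply/eqP; rewrite eq_le sm.1/=.
  by have := sm.1 (- x) (- y); rewrite -opprD !mN; lra.
move=> a x y; rewrite -[RHS]/(a * m x + m y) -[LHS]/(m (a *: x + y)) mD.
congr (_ + _); have [a0|a0] := lerP 0 a; first exact: sublinearZ.
by rewrite -[in LHS](opprK a) scaleNr mN (sublinearZ m) ?oppr_ge0 ?ltW// mulNr opprK.
Qed.

Lemma contractive_is_dual (f : V -> R^o) :
  linear f -> (forall x, `|f x| <= `|x|) -> f \in @is_dual R V.
Proof.
move=> lf f1; apply/mem_set; split=> //.
pose F : {linear V -> R^o} := HB.pack f (GRing.isLinear.Build R V R^o *:%R f lf).
suff : continuous F by [].
apply: bounded_linear_continuous.
apply/linear_boundedP; near=> r => x; apply: (le_trans (f1 x)).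
by rewrite ler_peMl.
Unshelve. all: by end_near. Qed.

(** A linear functional below [directional] of the norm at [x] is below the norm
    and at most [- `|x|] at [- x], hence equal to [`|x|] at [x]. *)
Lemma norming_functional (x : V) :
  exists2 f : dual V, unit_ball (dual V) f & f x = `|x|.
Proof.
have sn : sublinear (fun y : V => `|y|).
  by split=> [y z|a y a0]; [exact: ler_normD|rewrite normrZ ger0_norm].
have [sd dn dN] := directional_sublinear _ x sn.
have [m [sm md mmin]] := minimal_sublinear _ sd.
have lm := minimal_sublinear_linear m sm mmin.
have mN y : m (- y) = - m y.
  have := lm (-1) y 0; rewrite addr0 scaleN1r (sublinear0 _ sm) addr0 => ->.
  exact: scaleN1r.
have mn y : m y <= `|y| by exact: le_trans (md y) (dn y).
have m1 y : `|m y| <= `|y| by rewrite ler_norml mn lerNl -mN -normrN mn.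
exists (Dual (contractive_is_dual _ lm m1)).
  by apply: dual_norm_le => y y1; exact: le_trans (m1 y) y1.
apply/eqP; rewrite eq_le mn/= -lerN2 -mN.
exact: le_trans (md _) dN.
Qed.

End hahn_banach.

Section dual_ball.
Context {R : realType} {V : normedModType R}.
Implicit Types (f g : dual V) (x : V).

Lemma dual_norm_le_mul f x : `|f x| <= `|f| * `|x|.
Proof.
have [->|x0] := eqVneq x 0; first by rewrite linear0 !normr0 mulr0.
have := @dual_norm_ge _ _ f (`|x|^-1 *: x).
rewrite normrZ normfV normr_id mulVf ?normr_eq0// lexx linearZ/=.
by rewrite normrM normfV normr_id ler_pdivrMl ?normr_gt0// mulrC; exact.
Qed.

Lemma unit_ball_dual_le f x : unit_ball (dual V) f -> f x <= `|x|.
Proof.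
move=> f1; apply: (le_trans (ler_norm _)); apply: (le_trans (dual_norm_le_mul f x)).
by rewrite ler_piMl.
Qed.

Lemma sup_unit_ball_dual x :
  sup [set (u : dual V) x | u in unit_ball (dual V)] = `|x|.
Proof.
have [f f1 fx] := norming_functional x.
apply/eqP; rewrite eq_le; apply/andP; split.
  by apply: ge_sup => [|_ [u u1 <-]]; [exists (f x), f|exact: unit_ball_dual_le].
rewrite -fx; apply: ub_le_sup; last by exists f.
by exists `|x| => _ [u u1 <-]; exact: unit_ball_dual_le.
Qed.

Lemma dual_sumE (n : nat) (F : 'I_n -> dual V) x :
  (\sum_(i < n) F i) x = \sum_(i < n) F i x.
Proof. by apply: (big_morph (fun f : dual V => f x)). Qed.

Lemma unit_ball_convex (W : normedModType R) n (l : 'I_n -> R) (s : 'I_n -> W) :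
  (forall i, 0 <= l i) -> \sum_(i < n) l i = 1 -> (forall i, unit_ball W (s i)) ->
  unit_ball W (\sum_(i < n) l i *: s i).
Proof.
move=> l0 l1 s1; rewrite /unit_ball/= -l1; apply: (le_trans (ler_norm_sum _ _ _)).
by apply: ler_sum => i _; rewrite normrZ ger0_norm// ler_piMr//; exact: s1.
Qed.

Lemma diameter_eq2P (A : set V) : A `<=` unit_ball V ->
  diameter A = 2%:E <->
  forall e, 0 < e -> exists a b, [/\ A a, A b & 2 - e < `|a - b|].
Proof.
move=> A1; split=> [dA e e0|dA].
  have : ((2 - e)%:E < diameter A)%E by rewrite dA lte_fin; lra.
  move=> /ereal_sup_gt[_ [[a b] [/= Aa Ab] <-]]; rewrite lte_fin => ab.
  by exists a, b.
apply/eqP; rewrite eq_le; apply/andP; split.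
  apply: ub_ereal_sup => _ [[a b] [/= /A1 a1 /A1 b1] <-]; rewrite lee_fin.
  apply: (le_trans (ler_normB _ _)); rewrite /unit_ball/= in a1 b1; lra.
apply/lee_addgt0Pr => e e0; have [a [b [Aa Ab ab]]] := dA e e0.
apply: (@le_trans _ _ (`|a - b| + e)%:E); first by rewrite lee_fin; lra.
by rewrite EFinD leeD2r//; apply: ereal_sup_ubound; exists (a, b).
Qed.

End dual_ball.

(** * The w*-topology and slices of the dual ball *)

Section weak_star_topology.
Context {R : realType} {Z : normedModType R}.
Implicit Types (f g : dual Z) (z : Z).

Lemma eval_wstar_continuous z :
  continuous ((fun f : weak_star Z => (f : dual Z) z) : weak_star Z -> R^o).
Proof.
pose i : weak_star Z -> {ptws Z -> R^o} := @dual_fun R Z.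
pose p : {ptws Z -> R^o} -> R^o := fun h => h z.
suff : continuous (p \o i) by [].
move=> f; apply: continuous_comp; first exact: initial_continuous.
exact: (@proj_continuous Z (fun=> R^o) z).
Qed.

Lemma wstar_cvg {T : Type} (F : set_system T) (h : T -> dual Z) f :
  Filter F -> (forall z, (fun t => h t z : R^o) @ F --> (f z : R^o)) ->
  (h : T -> weak_star Z) @ F --> (f : weak_star Z).
Proof.
move=> FF hf U /= [_ [[A oA <-]] Af] /filterS; apply.
have : {ptws, (fun t => h t : Z -> R^o) @ F --> (f : Z -> R^o)}.
  by apply/pointwise_cvgP.
by apply; exact: open_nbhs_nbhs.
Qed.

(** The sets of functionals close to [f] on a finite set form a filter base; the
    filter converges pointwise to [f], hence is finer than the neighbourhoods. *)
Lemma wstar_basic_nbhs (U : set (weak_star Z)) (f : dual Z) : open U -> U f ->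
  exists (s : seq Z) (d : R), 0 < d /\
    forall g : dual Z, (forall z, z \in s -> `|g z - f z| <= d) -> U g.
Proof.
move=> oU Uf.
pose B (sd : seq Z * R) : set (dual Z) :=
  [set g | forall z, z \in sd.1 -> `|g z - f z| <= sd.2].
pose F := filter_from [set sd : seq Z * R | 0 < sd.2] B.
have FF : Filter F.
  apply: filter_from_filter; first by exists ([::], 1) => /=.
  move=> [s d] [s' d'] /= d0 d'0; exists (s ++ s', Order.min d d') => /=.
    by rewrite lt_min d0.
  move=> g gB; split=> z zs; have /= := gB z; rewrite mem_cat zs ?orbT => /(_ isT).
    by rewrite le_min => /andP[].
  by rewrite le_min => /andP[].
have /(_ U) : (id : dual Z -> weak_star Z) @ F --> (f : weak_star Z).
  apply: wstar_cvg => z; apply/cvgrPdist_le => e e0.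
  exists ([:: z], e) => //= g /(_ z); rewrite mem_head distrC; exact.
move=> /(_ (open_nbhs_nbhs (conj oU Uf)))[[s d] /= d0 sdU].
by exists s, d; split=> // g gf; exact: sdU.
Qed.

End weak_star_topology.

Section slices.
Context {R : realType} {Z : normedModType R}.
Implicit Types (f g : dual Z) (z : Z).

Lemma wstar_sliceE z (a : R) :
  wstar_slice z a = unit_ball (dual Z) `&` [set f | `|z| - a < f z].
Proof. by rewrite /wstar_slice sup_unit_ball_dual. Qed.

Lemma wstar_slice_open (S : set (dual Z)) :
  is_wstar_slice S -> is_relatively_wstar_open S /\ S !=set0.
Proof.
move=> [z [a [a0 ->]]]; rewrite wstar_sliceE; split.
  exists [set f | `|z| - a < f z]; split=> //.
  apply: (@open_comp _ _ (fun f : weak_star Z => (f : dual Z) z) [set y | `|z| - a < y]).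
    by move=> f _; exact: eval_wstar_continuous.
  exact: open_gt.
have [f f1 fz] := norming_functional z.
by exists f; split=> //=; rewrite fz ltrBlDr ltrDl.
Qed.

(** If slices have diameter 2, then no finite subset [s] of [Z] controls the norm
    of functionals.  Endow [Z^*] with the Hilbertian seminorm
    [f |-> (\sum_(z <- s) f z ^+ 2)^(1/2)] and choose [f1] in the dual ball almost
    maximizing it.  The inner product with [f1] is evaluation at
    [w = \sum_(z <- s) f1 z *: z], so that expanding the square of the seminorm
    distance to [f1] shows it to be small on the slice given by [w]; but it contains two functionals
    at norm distance more than 1, whose difference is the functional sought. *)
Lemma big_functional_small_on_finite (s : seq Z) (d : R) :
  (forall S : set (dual Z), is_wstar_slice S -> diameter S = 2%:E) -> 0 < d ->
  exists2 g : dual Z, 1 <= `|g| & forall z, z \in s -> `|g z| <= d.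
Proof.
move=> slice_diam d0; pose q f := \sum_(z <- s) f z ^+ 2.
pose Q := [set q f | f in unit_ball (dual Z)].
have supQ : has_sup Q.
  split; first by exists (q 0), 0 => //; rewrite /unit_ball/= normr0.
  exists (\sum_(z <- s) `|z| ^+ 2) => _ [f f1 <-]; apply: ler_sum => z _.
  rewrite -[f z ^+ 2]real_normK ?num_real// lerXn2r ?nnegrE//.
  apply: (le_trans (dual_norm_le_mul f z)).
  by rewrite ler_piMl.
have Qle f : unit_ball (dual Z) f -> q f <= sup Q.
  by move=> f1; apply: ub_le_sup; [exact: supQ.2|exists f].
(* [a] is such that seminorm distance [2 * sqrt a] to [f1] means [d / 2]. *)
pose a := d ^+ 2 / 16.
have a0 : 0 < a by rewrite divr_gt0// exprn_gt0.
have [_ [f1 f1B <-] f1a] := sup_adherent a0 supQ.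
pose w := \sum_(z <- s) f1 z *: z.
have f1w f : f w = \sum_(z <- s) f1 z * f z.
  by rewrite linear_sum; apply: eq_bigr => z _; rewrite linearZ.
have sqr_le_norm (y c : R) : 0 <= c -> y ^+ 2 <= c ^+ 2 -> `|y| <= c.
  by move=> c0 yc; rewrite -ler_sqr ?nnegrE// real_normK ?num_real.
have near_f1 f z : wstar_slice w a f -> z \in s -> `|f z - f1 z| <= d / 2.
  rewrite wstar_sliceE => -[fB /= fw] zs.
  have wq : q f1 <= `|w|.
    apply: le_trans (unit_ball_dual_le f1 w f1B).
    by rewrite f1w; apply: ler_sum => y _; rewrite expr2.
  have dq : \sum_(y <- s) (f y - f1 y) ^+ 2 = q f + q f1 - 2 * f w.
    rewrite /q f1w -big_split/= mulr_sumr -sumrB; apply: eq_bigr => y _; ring.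
  have zdq : (f z - f1 z) ^+ 2 <= \sum_(y <- s) (f y - f1 y) ^+ 2.
    rewrite (big_rem z)//= lerDl sumr_ge0// => y _; exact: sqr_ge0.
  have := Qle f fB; have := Qle f1 f1B => q1 q2.
  apply: sqr_le_norm; first by rewrite divr_ge0// ltW.
  rewrite (_ : (d / 2) ^+ 2 = 4 * a); last by rewrite /a; field.
  lra.
have sub1 : wstar_slice w a `<=` unit_ball (dual Z) by move=> f [].
have [f [h [Sf Sh fh]]] :=
  (diameter_eq2P _ sub1).1 (slice_diam _ (ex_intro _ w (ex_intro _ a (conj a0 erefl)))) 1 ltr01.
exists (f - h); first by apply: ltW; lra.
move=> z zs; rewrite -[_ z]/(f z - h z) (le_trans (ler_distD (f1 z) _ _))//.
have := near_f1 f z Sf zs; have := near_f1 h z Sh zs; rewrite (distrC (h z)); lra.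
Qed.

(** If [g] of norm at least 1 is small on the finite set that witnesses [U] being a
    neighbourhood of [f0], the segment from [f0] to [f0 + 2 *: g] stays in [U], and
    it starts in the unit ball and ends outside of its interior. *)
Lemma wstar_open_meets_sphere (W : set (dual Z)) :
  (forall S : set (dual Z), is_wstar_slice S -> diameter S = 2%:E) ->
  is_relatively_wstar_open W -> W !=set0 -> exists2 f, W f & `|f| = 1.
Proof.
move=> slice_diam [U [oU ->]] [f0 [f01 Uf0]].
have [s [d [d0 sdU]]] := wstar_basic_nbhs U f0 oU Uf0.
have [g g1 gs] := big_functional_small_on_finite s (d / 2) slice_diam (divr_gt0 d0 (ltr0n _ 2)).
pose phi (t : R) : R := `|f0 + t *: g|.
have cphi : continuous phi.
  move=> t; apply: cvg_norm; apply: cvgD; first exact: cvg_cst.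
  by apply: cvgZr_tmp; exact: cvg_id.
have [||t /andP[t0 t2] pt] := @IVT R phi 0 2 1 (ler0n _ 2).
- exact: continuous_subspaceT.
- rewrite ge_min le_max /phi scale0r addr0; apply/andP; split.
    by apply/orP; left; exact: f01.
  apply/orP; right; have := ler_normB (f0 + 2 *: g) f0.
  rewrite [f0 + _]addrC addrK normrZ ger0_norm//.
  have : `|f0| <= 1 := f01; lra.
exists (f0 + t *: g) => //; split; first by rewrite /unit_ball/= -/(phi t) pt.
apply: sdU => z zs.
rewrite (_ : (f0 + t *: g) z - f0 z = t * g z); last first.
  by rewrite -[(f0 + t *: g) z]/(f0 z + t * g z) addrC addKr.
rewrite normrM ger0_norm//; have := gs z zs; have := normr_ge0 (g z) => ? ?.
rewrite (_ : d = 2 * (d / 2)); last by field.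
exact: ler_pM.
Qed.

End slices.

(** * Adjoints of contractions *)

Section adjoint.
Context {R : realType} {X Z : normedModType R} (T : {linear X -> Z}).
Context (T1 : forall x, `|T x| <= `|x|).

Lemma adjoint_is_dual (F : dual Z) : (F \o T : X -> R^o) \in @is_dual R X.
Proof.
apply/mem_set; split; first by move=> a x y; rewrite /= !linearP.
move=> x; apply: continuous_comp; last exact: dual_continuous.
apply: bounded_linear_continuous; apply/linear_boundedP.
by near=> r => y; rewrite (le_trans (T1 y))// ler_peMl.
Unshelve. all: by end_near. Qed.

Definition adjoint (F : dual Z) : dual X := Dual (adjoint_is_dual F).

Lemma adjoint_norm (F : dual Z) : `|adjoint F| <= `|F|.
Proof.
apply: dual_norm_le => x x1.
exact: (@dual_norm_ge _ _ F (T x) (le_trans (T1 x) x1)).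
Qed.

Lemma adjoint_unit_ball (F : dual Z) :
  unit_ball (dual Z) F -> unit_ball (dual X) (adjoint F).
Proof. exact: le_trans (adjoint_norm F). Qed.

Lemma adjointB (F G : dual Z) : adjoint (F - G) = adjoint F - adjoint G.
Proof. exact/val_inj. Qed.

Lemma adjoint_sum n (l : 'I_n -> R) (F : 'I_n -> dual Z) :
  adjoint (\sum_(i < n) l i *: F i) = \sum_(i < n) l i *: adjoint (F i).
Proof.
by apply/val_inj/funext => x /=; rewrite !dual_sumE.
Qed.

Lemma adjoint_wstar_continuous :
  continuous (adjoint : weak_star Z -> weak_star X).
Proof.
move=> F; apply: (@wstar_cvg _ _ _ (nbhs (F : weak_star Z)) adjoint) => x.
exact: (eval_wstar_continuous (T x)).
Qed.

End adjoint.

(** * Diameter two properties pass to M-summands *)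

(** [X] is an M-summand of [Z]: [J] embeds it, [P] projects onto it, and [JM] says
    that the norm of [Z] is the maximum of the norms of the two components:
    the component of [z] complementary to [X] is [z - J (P z)]. *)
Section M_summand.
Context {R : realType} {X Z : normedModType R}.
Context (J : {linear X -> Z}) (P : {linear Z -> X}).
Context (J1 : forall x, `|J x| <= `|x|) (P1 : forall z, `|P z| <= `|z|).
Context (PJ : cancel J P).
Context (JM : forall r x z, `|x| <= r -> `|z| <= r -> `|J x + (z - J (P z))| <= r).

Let Ja : dual Z -> dual X := adjoint J J1.
Let Pa : dual X -> dual Z := adjoint P P1.

Lemma M_summand_norm x : `|J x| = `|x|.
Proof. by apply/eqP; rewrite eq_le J1/= -{1}(PJ x). Qed.

Lemma M_summand_adjointK (f : dual X) : Ja (Pa f) = f.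
Proof. by apply/val_inj/funext => x /=; rewrite PJ. Qed.

(** For [z] in the ball of radius [r], [J x + (z - J (P z))] is again in that ball,
    so that [F] takes there a value at most [r]; this bounds [F (z - J (P z))],
    which is the value of [F - Pa (Ja F)] at [z], by [r - F (J x)]. *)
Lemma M_summand_remainder (F : dual Z) (r : R) x :
  unit_ball (dual Z) F -> 0 < r -> `|x| <= r ->
  r * `|F - Pa (Ja F)| <= r - F (J x).
Proof.
move=> F1 r0 xr; rewrite -ler_pdivlMl//; apply: dual_norm_le => z z1.
have E y : (F - Pa (Ja F)) y = F (y - J (P y)) by rewrite linearB.
have key y : `|y| <= 1 -> r * F (y - J (P y)) <= r - F (J x).
  move=> y1; have ry : `|r *: y| <= r by rewrite normrZ gtr0_norm// ler_piMr// ltW.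
  have := unit_ball_dual_le F (J x + (r *: y - J (P (r *: y)))) F1.
  move=> /le_trans/(_ (JM _ _ _ xr ry)).
  rewrite (_ : r *: y - _ = r *: (y - J (P y))); last first.
    by rewrite scalerBr !linearZ.
  by rewrite linearD linearZ/= -lerBrDl.
rewrite E ler_norml; apply/andP; split; last by rewrite ler_pdivlMl// key.
rewrite lerNl ler_pdivlMl// -linearN opprB.
have := key (- z); rewrite normrN => /(_ z1).
by rewrite !linearN/= opprK addrC.
Qed.

(** Discarding complementary parts of norm at most [e] costs at most [2 * e] in
    distances, and [Pa] does not increase norms. *)
Lemma M_summand_diameter (B : set (dual X)) :
  B `<=` unit_ball (dual X) ->
  (forall e, 0 < e -> exists A : set (dual Z),
    [/\ A `<=` unit_ball (dual Z), diameter A = 2%:E &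
        forall F, A F -> B (Ja F) /\ `|F - Pa (Ja F)| <= e]) ->
  diameter B = 2%:E.
Proof.
move=> B1 BA; apply/diameter_eq2P => // e e0.
have e30 : 0 < e / 3 by rewrite divr_gt0.
have [A [A1 dA AB]] := BA _ e30.
have [F [G [AF AG FG]]] := (diameter_eq2P _ A1).1 dA _ e30.
exists (Ja F), (Ja G); split; [exact: (AB F AF).1|exact: (AB G AG).1|].
have PFG : `|Pa (Ja F - Ja G)| <= `|Ja F - Ja G| by exact: adjoint_norm.
have FGE : F - G = (F - Pa (Ja F)) + Pa (Ja F - Ja G) - (G - Pa (Ja G)).
  by rewrite /Pa adjointB addrA subrK opprB addrA addrNK.
rewrite FGE in FG.
have := ler_normB (F - Pa (Ja F) + Pa (Ja F - Ja G)) (G - Pa (Ja G)).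
have := ler_normD (F - Pa (Ja F)) (Pa (Ja F - Ja G)).
have := (AB F AF).2; have := (AB G AG).2; lra.
Qed.

Context (X_neq0 : exists x : X, x != 0).

(** The slice of [Z] is given by [J y] for the same [y], with a width [c] at most
    [e * `|y|] so that [M_summand_remainder] with [r = `|y|] bounds the
    complementary part by [e]. *)
Lemma M_summand_slice (S : set (dual X)) (e : R) : is_wstar_slice S -> 0 < e ->
  exists2 T : set (dual Z), is_wstar_slice T &
    forall F, T F -> S (Ja F) /\ `|F - Pa (Ja F)| <= e.
Proof.
move=> [x [a [a0 SE]]] e0.
(* A slice given by [0] is the whole ball and contains slices given by any
   nonzero vector; this is where the hypothesis that [X] is nonzero enters. *)
have [y [b [b0 y0 yS]]] : exists y b, [/\ 0 < b, y != 0 & wstar_slice y b `<=` S].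
  have [x0|x0] := eqVneq x 0; last by exists x, a; split=> //; rewrite SE.
  have [y y0] := X_neq0; exists y, 1; split=> // f; rewrite SE !wstar_sliceE x0.
  by move=> [f1 _]; split=> //=; rewrite linear0 normr0 sub0r oppr_lt0.
have ny0 : 0 < `|y| by rewrite normr_gt0.
pose c := Order.min b (e * `|y|).
have c0 : 0 < c by rewrite lt_min b0 mulr_gt0.
exists (wstar_slice (J y) c); first by exists (J y), c.
move=> F; rewrite wstar_sliceE M_summand_norm => -[F1 /= Fy].
have [cb ce] : c <= b /\ c <= e * `|y| by rewrite !ge_min !lexx orbT.
split.
  apply: yS; rewrite wstar_sliceE; split; first exact: adjoint_unit_ball.
  by apply: le_lt_trans Fy; rewrite lerB.
rewrite -(ler_pM2l ny0) (le_trans (M_summand_remainder F _ y F1 ny0 (lexx _)))//.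
by rewrite (mulrC _ e); lra.
Qed.

Lemma M_summand_slice_diameter_two :
  (forall S : set (dual Z), is_wstar_slice S -> diameter S = 2%:E) ->
  forall S : set (dual X), is_wstar_slice S -> diameter S = 2%:E.
Proof.
move=> dZ S slS; apply: M_summand_diameter => [|e e0].
  by have [x [a [_ ->]]] := slS; move=> f [].
have [T slT TS] := M_summand_slice S e slS e0.
exists T; split=> //; last exact: dZ.
by have [z [a [_ ->]]] := slT; move=> f [].
Qed.

(** [M_summand_slice] applies to each slice; the complementary part of a convex
    combination is the convex combination of the complementary parts. *)
Lemma M_summand_strong_diameter_two :
  (forall C : set (dual Z), is_convex_comb_wstar_slices C -> diameter C = 2%:E) ->
  forall C : set (dual X), is_convex_comb_wstar_slices C -> diameter C = 2%:E.
Proof.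
have ball1 (V : normedModType R) n (S : 'I_n -> set (dual V)) l :
    (forall i, is_wstar_slice (S i)) -> (forall i, 0 <= l i <= 1) ->
    \sum_(i < n) l i = 1 ->
    [set \sum_(i < n) l i *: s i | s in [set s | forall i, S i (s i)]]
      `<=` unit_ball (dual V).
  move=> slS l01 l1 _ [s Ss <-]; apply: unit_ball_convex => // i.
    by have /andP[] := l01 i.
  by have [z [a [_ SE]]] := slS i; have := Ss i; rewrite SE => -[].
move=> dZ C [n [S [l [n0 slS l01 l1 CE]]]].
apply: M_summand_diameter => [|e e0]; first by rewrite CE; exact: ball1.
have /choice[T TP] i : exists T : set (dual Z), is_wstar_slice T /\
    forall F, T F -> S i (Ja F) /\ `|F - Pa (Ja F)| <= e.
  by have [T slT TS] := M_summand_slice (S i) e (slS i) e0; exists T.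
pose D := [set \sum_(i < n) l i *: s i | s in [set s | forall i, T i (s i)]].
exists D; split.
- by apply: ball1 => // i; exact: (TP i).1.
- by apply: dZ; exists n, T, l; split=> // i; exact: (TP i).1.
move=> _ [s Ts <-]; split.
  rewrite CE /Ja adjoint_sum; exists (fun i => Ja (s i)) => // i.
  exact: ((TP i).2 _ (Ts i)).1.
rewrite /Ja adjoint_sum /Pa adjoint_sum -sumrB -[e]mul1r -l1 mulr_suml.
apply: (le_trans (ler_norm_sum _ _ _)); apply: ler_sum => i _.
have /andP[l0 _] := l01 i.
by rewrite -scalerBr normrZ ger0_norm// ler_wpM2l//; exact: ((TP i).2 _ (Ts i)).2.
Qed.

(** The norm 1 functional [f] of [W] provides a vector [x] with [f x > 1 - e] and
    the element [Pa f] of the open set [U'], whose members are close to their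
    [X^*]-part because they exceed [1 - e] at [J x]. *)
Lemma M_summand_wstar_diameter_two :
  (forall W : set (dual Z),
    is_relatively_wstar_open W -> W !=set0 -> diameter W = 2%:E) ->
  forall W : set (dual X),
    is_relatively_wstar_open W -> W !=set0 -> diameter W = 2%:E.
Proof.
move=> dZ W oW W0.
have slX : forall S : set (dual X), is_wstar_slice S -> diameter S = 2%:E.
  apply: M_summand_slice_diameter_two => S /wstar_slice_open[oS S0]; exact: dZ.
have [f Wf f1] := wstar_open_meets_sphere W slX oW W0.
have [U [oU WE]] := oW.
apply: M_summand_diameter => [|e e0]; first by rewrite WE; exact: subIsetl.
have [_ [x x1 <-] fx] := sup_adherent e0 (dual_norm_has_sup f).
rewrite -dual_normE f1 in fx.
have {x x1 fx}[x x1 fx] : exists2 x, `|x| <= 1 & 1 - e < f x.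
  have [fx0|fx0] := lerP 0 (f x); first by exists x => //; rewrite ger0_norm in fx.
  by exists (- x); [rewrite normrN|rewrite linearN/=; rewrite ltr0_norm in fx].
pose U' : set (weak_star Z) :=
  (Ja : weak_star Z -> weak_star X) @^-1` U `&` [set F | 1 - e < (F : dual Z) (J x)].
have oU' : open U'.
  apply: openI.
    by apply: open_comp oU => F _; exact: (adjoint_wstar_continuous J J1).
  apply: (@open_comp _ _ (fun F : weak_star Z => (F : dual Z) (J x)) [set y | 1 - e < y]).
    by move=> F _; exact: eval_wstar_continuous.
  exact: open_gt.
exists (unit_ball (dual Z) `&` U'); split.
- exact: subIsetl.
- apply: dZ; first by exists U'.
  rewrite WE in Wf; exists (Pa f); split; first by apply: adjoint_unit_ball; exact: Wf.1.
  by split; [rewrite /preimage/= M_summand_adjointK; exact: Wf.2|rewrite /= PJ].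
move=> F [F1 [UF /= Fx]]; split.
  by rewrite WE; split=> //; exact: adjoint_unit_ball.
have := M_summand_remainder F 1 x F1 ltr01 x1; rewrite mul1r; lra.
Qed.

End M_summand.

(** * An isolated point of K makes X an M-summand of C(K, X) *)

Section isolated_point.
Context {R : realType} {K : topologicalType} (cK : compact [set: K]).
Context (X : normedModType R) (k0 : K).
Local Notation C := (contfun cK X).

Definition at_point (f : C) : X := f k0.

Lemma at_point_linear : linear at_point.
Proof. by []. Qed.

HB.instance Definition _ := GRing.isLinear.Build R C X *:%R at_point at_point_linear.

Context (hK : hausdorff_space K) (k0_isolated : isolated [set: K] k0).

Definition spike_fun (x : X) (k : K) : X := if k == k0 then x else 0.

(** [k0] being isolated and [K] separated, both [k0] and its complement are open,
    and the function is locally constant. *)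
Lemma spike_is_contfun x : spike_fun x \in @is_contfun R K X.
Proof.
apply/mem_set => k; apply: cvg_near_cst.
have [->|kk0] := eqVneq k k0.
  have [_ [V nV VE]] := k0_isolated; rewrite setIT in VE.
  by apply: filterS nV => l; rewrite VE /spike_fun => ->; rewrite eqxx.
have : open (~` [set k0]).
  exact/closed_openC/accessible_closed_set1/hausdorff_accessible.
move=> oK; have : nbhs k (~` [set k0]).
  by apply: open_nbhs_nbhs; split=> //; exact/eqP.
by apply: filterS => l /eqP lk0; rewrite /spike_fun (negbTE kk0) (negbTE lk0).
Qed.

Definition spike (x : X) : C := Contfun cK (spike_is_contfun x).

Lemma spike_linear : linear spike.
Proof.
move=> a x y; apply: contfun_inj; apply/funext => k.
rewrite -[RHS]/(a *: spike_fun x k + spike_fun y k) -[LHS]/(spike_fun (a *: x + y) k).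
by rewrite /spike_fun; case: ifP => // _; rewrite scaler0 addr0.
Qed.

HB.instance Definition _ := GRing.isLinear.Build R X C *:%R spike spike_linear.

Lemma spike_le x : `|spike x| <= `|x|.
Proof.
apply: sup_norm_le => // k; rewrite -[_ k]/(spike_fun x k) /spike_fun.
by case: ifP; rewrite ?normr0.
Qed.

Lemma at_point_le (f : C) : `|at_point f| <= `|f|.
Proof. exact: sup_norm_ge. Qed.

Lemma spikeK : cancel spike at_point.
Proof. by move=> x; rewrite -[LHS]/(spike_fun x k0) /spike_fun eqxx. Qed.

Lemma spike_M_summand r x (f : C) :
  `|x| <= r -> `|f| <= r -> `|spike x + (f - spike (at_point f))| <= r.
Proof.
move=> xr fr; apply: sup_norm_le => [|k]; first exact: le_trans xr.
have fk : `|f k| <= r := le_trans (sup_norm_ge f k) fr.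
rewrite -[X in `|X|]/(spike_fun x k + (f k - spike_fun (at_point f) k)) /spike_fun.
by have [->|_] := eqVneq k k0; rewrite ?subrr ?addr0// add0r subr0.
Qed.

End isolated_point.

Theorem corollary6 (R : realType) (K : topologicalType)
    (cK : compact [set: K]) (hK : hausdorff_space K)
    (K_isolated : exists k : K, isolated [set: K] k)
    (X : completeNormedModType R) (X_neq0 : exists x : X, x != 0) :
  [/\ wstar_strong_diameter_two (contfun cK X) -> wstar_strong_diameter_two X,
      wstar_diameter_two (contfun cK X) -> wstar_diameter_two X &
      wstar_slice_diameter_two (contfun cK X) -> wstar_slice_diameter_two X].
Proof.
have [k0 k0_isolated] := K_isolated.
have J1 := spike_le cK X k0 hK k0_isolated.
have P1 := at_point_le cK X k0.
have PJ := spikeK cK X k0 hK k0_isolated.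
have JM := spike_M_summand cK X k0 hK k0_isolated.
split.
- exact: (M_summand_strong_diameter_two _ _ J1 P1 PJ JM).
- exact: (M_summand_wstar_diameter_two _ _ J1 P1 PJ JM).
- exact: (M_summand_slice_diameter_two _ _ J1 P1 PJ JM).
Qed.
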